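(* Let $\kappa,\tau\in\mathbb{R}$ with $\kappa\neq 4\tau^2$. Among the Bianchi-Cartan-Vranceanu spaces $\widetilde{M}^3(\kappa,\tau)$ with $\kappa\neq4\tau^2$, the only ones admitting totally umbilical surfaces are the Riemannian products $(\mathbb{S}^2(\kappa)\setminus\{\infty\})\times\mathbb{R}$ (the case $\kappa>0$, $\tau=0$) and $\mathbb{H}^2(\kappa)\times\mathbb{R}$ (the case $\kappa<0$, $\tau=0$). That is, $\widetilde{M}^3(\kappa,\tau)$ admits a totally umbilical surface if and only if $\tau=0$.
   Context: For $\kappa,\tau\in\mathbb{R}$ the Bianchi-Cartan-Vranceanu space (BCV space) $\widetilde{M}^3(\kappa,\tau)$ is the open set $\{(x,y,z)\in\mathbb{R}^3 \mid 1+\frac{\kappa}{4}(x^2+y^2)>0\}$ with the Riemannian metric $$ds^2=\frac{dx^2+dy^2}{(1+\frac{\kappa}{4}(x^2+y^2))^2}+\left(dz+\tau\frac{y\,dx-x\,dy}{1+\frac{\kappa}{4}(x^2+y^2)}\right)^2.$$ If $\tau=0$ and $\kappa>0$ it is isometric to $(\mathbb{S}^2(\kappa)\setminus\{\infty\})\times\mathbb{R}$, and if $\tau=0$ and $\kappa<0$ it is isometric to $\mathbb{H}^2(\kappa)\times\mathbb{R}$, where $\mathbb{S}^2(\kappa)$ and $\mathbb{H}^2(\kappa)$ denote the sphere and the hyperbolic plane of constant Gaussian curvature $\kappa$. A (smooth, isometrically immersed) surface in a Riemannian 3-manifold is totally umbilical if at every point its shape operator $S$ is a scalar multiple of the identity,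 $S=\lambda\,\mathrm{id}$. Surfaces are understood locally (not assumed complete); totally geodesic surfaces ($\lambda=0$) count as totally umbilical. *)

(* Defs.v *)
From Stdlib Require Import Reals.
From Coquelicot Require Import Coquelicot.
Open Scope R_scope.

Inductive coord : Set := cX | cY | cZ.

Definition coord_eqb (i j : coord) : bool :=
  match i, j with cX, cX | cY, cY | cZ, cZ => true | _, _ => false end.

(* Cyclic successor, used to write 3x3 cofactors without signs. *)
Definition nxt (i : coord) : coord :=
  match i with cX => cY | cY => cZ | cZ => cX end.

Definition sum3 (F : coord -> R) : R := F cX + F cY + F cZ.

Definition vec : Type := coord -> R.

Definition basis (i : coord) : vec := fun j => if coord_eqb i j then 1 else 0.

Definition upd (p : vec) (i : coord) (t : R) : vec :=
  fun j => if coord_eqb i j then t else p j.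

Definition partial (i : coord) (h : vec -> R) (p : vec) : R :=
  Derive (fun t => h (upd p i t)) (p i).

(* [g p v w] is the inner product of the vectors [v] and [w] at the point [p]. *)
Definition metric : Type := vec -> vec -> vec -> R.

Section Riemannian.

Variable g : metric.

Definition gcoef (i j : coord) (p : vec) : R := g p (basis i) (basis j).

(* Cofactor of the (i,j) entry; the cyclic indexing absorbs the sign. *)
Definition gcof (i j : coord) (p : vec) : R :=
  gcoef (nxt i) (nxt j) p * gcoef (nxt (nxt i)) (nxt (nxt j)) p
  - gcoef (nxt i) (nxt (nxt j)) p * gcoef (nxt (nxt i)) (nxt j) p.

Definition gdet (p : vec) : R := sum3 (fun j => gcoef cX j p * gcof cX j p).

Definition ginv (i j : coord) (p : vec) : R := gcof j i p / gdet p.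

(* Christoffel symbol Gamma^k_{ij} of the Levi-Civita connection. *)
Definition christoffel (k i j : coord) (p : vec) : R :=
  / 2 * sum3 (fun l => ginv k l p *
    (partial i (gcoef j l) p + partial j (gcoef i l) p - partial l (gcoef i j) p)).

(* [pushforward f u v a b] is df_(u,v)(a,b). *)
Definition pushforward (f : R -> R -> vec) (u v a b : R) : vec := fun k =>
  a * Derive (fun s => f s v k) u + b * Derive (fun t => f u t k) v.

(* Covariant derivative of the vector field [V] along the map [f] in the
   direction (a,b) of the parameter plane. *)
Definition cov_deriv (f V : R -> R -> vec) (u v a b : R) : vec := fun k =>
  pushforward V u v a b k
  + sum3 (fun i => sum3 (fun j =>
      christoffel k i j (f u v) * pushforward f u v a b i * V u v j)).

(* S(df(a,b)) = - nabla_(a,b) N, for the unit normal field [N] along [f]. *)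
Definition shape_operator (f N : R -> R -> vec) (u v a b : R) : vec := fun k =>
  - cov_deriv f N u v a b k.

(* C^infinity on [U]: all iterated partial derivatives of all components exist
   and are continuous at every point of [U]. *)
Definition smooth_on (U : R * R -> Prop) (f : R -> R -> vec) : Prop :=
  forall u v, U (u, v) ->
  forall (k : coord) (n : nat), ex_diff_n (fun s t => f s t k) n u v.

Definition immersed_surface (D : vec -> Prop) (U : R * R -> Prop)
    (f : R -> R -> vec) : Prop :=
  open U /\ (exists w, U w) /\ smooth_on U f /\
  forall u v, U (u, v) ->
    D (f u v) /\
    forall a b, (forall k, pushforward f u v a b k = 0) -> a = 0 /\ b = 0.

Definition unit_normal (U : R * R -> Prop) (f N : R -> R -> vec) : Prop :=
  smooth_on U N /\
  forall u v, U (u, v) ->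
    g (f u v) (N u v) (N u v) = 1 /\
    forall a b, g (f u v) (N u v) (pushforward f u v a b) = 0.

Definition totally_umbilical (U : R * R -> Prop) (f N : R -> R -> vec) : Prop :=
  forall u v, U (u, v) ->
  exists lambda : R, forall a b k,
    shape_operator f N u v a b k = lambda * pushforward f u v a b k.

(* Surfaces are local: parametrized patches over nonempty open subsets of the
   plane. The unit normal is unique up to sign on each component of [U],
   and umbilicity does not depend on that sign. *)
Definition admits_totally_umbilical_surface (D : vec -> Prop) : Prop :=
  exists (U : R * R -> Prop) (f N : R -> R -> vec),
    immersed_surface D U f /\ unit_normal U f N /\ totally_umbilical U f N.

End Riemannian.

Definition bcv_factor (kappa : R) (p : vec) : R :=
  1 + kappa / 4 * ((p cX) ^ 2 + (p cY) ^ 2).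

Definition bcv_domain (kappa : R) (p : vec) : Prop := 0 < bcv_factor kappa p.

(* The polarization of ds^2. *)
Definition bcv_metric (kappa tau : R) : metric := fun p v w =>
  let d := bcv_factor kappa p in
  let eta (x : vec) := x cZ + tau * ((p cY * x cX - p cX * x cY) / d) in
  (v cX * w cX + v cY * w cY) / d ^ 2 + eta v * eta w.

Definition bcv_admits_totally_umbilical_surface (kappa tau : R) : Prop :=
  admits_totally_umbilical_surface (bcv_metric kappa tau) (bcv_domain kappa).

(* Main.v *)
Require Import Defs.
From Stdlib Require Import Reals Lra FunctionalExtensionality.
From Coquelicot Require Import Coquelicot.
Open Scope R_scope.

(* Let xi = d/dz, K = kappa - 4 tau^2, and let T^b be the restriction of the
   1-form <xi, .> to a surface with unit normal N. If the surface is umbilical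
   with factor lambda, the Codazzi equation reads d lambda = - K <N, xi> T^b,
   so <N, xi> T^b is closed when K <> 0. Since nabla_X xi = tau X x xi, closedness means
   tau (3 <N, xi>^2 - 1) = 0. If tau <> 0 the angle function <N, xi> is
   therefore a nonzero constant, so T^b itself is closed; but
   d T^b = 2 tau <N, xi> dA up to sign, a contradiction. Conversely, for tau = 0
   the slice z = 0 is totally geodesic. *)

(** * Smooth functions on an open subset of the plane *)

Definition du (h : R -> R -> R) : R -> R -> R := fun u v => Derive (fun s => h s v) u.
Definition dv (h : R -> R -> R) : R -> R -> R := fun u v => Derive (fun t => h u t) v.

(** The order is kept explicit because the closure rules below go by induction on [n]: derivatives
    of sums, products and inverses are rebuilt at order [n]. *)
Definition diff_n_on (U : R * R -> Prop) (n : nat) (h : R -> R -> R) : Prop :=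
  forall u v, U (u, v) -> ex_diff_n h n u v.

Definition smooth_fun (U : R * R -> Prop) (h : R -> R -> R) : Prop :=
  forall n, diff_n_on U n h.

Lemma open_locally_2d (U : R * R -> Prop) (P : R -> R -> Prop) (u v : R) :
  open U -> (forall s t, U (s, t) -> P s t) -> U (u, v) -> locally_2d P u v.
Proof.
  intros hU hP huv. apply locally_2d_locally.
  apply filter_imp with (P := U); [intros [s t]; apply hP | exact (hU _ huv)].
Qed.

Lemma open_locally_fst (U : R * R -> Prop) (P : R -> R -> Prop) (u v : R) :
  open U -> (forall s t, U (s, t) -> P s t) -> U (u, v) ->
  locally u (fun s => P s v).
Proof.
  intros hU hP huv. apply locally_2d_1d_const_y.
  now apply open_locally_2d with (U := U).
Qed.

Lemma open_locally_snd (U : R * R -> Prop) (P : R -> R -> Prop) (u v : R) :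
  open U -> (forall s t, U (s, t) -> P s t) -> U (u, v) ->
  locally v (fun t => P u t).
Proof.
  intros hU hP huv. apply locally_2d_1d_const_x.
  now apply open_locally_2d with (U := U).
Qed.

(** Openness turns agreement on [U] into agreement near each point, which is all that derivatives
    see. This lets [du] and [dv] be replaced by formulas valid only on [U]. *)
Lemma diff_n_on_ext (U : R * R -> Prop) (n : nat) (h k : R -> R -> R) :
  open U -> (forall u v, U (u, v) -> h u v = k u v) ->
  diff_n_on U n h -> diff_n_on U n k.
Proof.
  intros hU e hh u v huv. apply ex_diff_n_ext_loc with (f := h); [| now apply hh].
  now apply open_locally_2d with (U := U).
Qed.

Lemma diff_n_on_0 (U : R * R -> Prop) (h : R -> R -> R) :
  diff_n_on U 0 h <-> (forall u v, U (u, v) -> continuity_2d_pt h u v).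
Proof.
  split; intros hh u v huv; [exact (proj1 (hh u v huv)) | now split; [apply hh |]].
Qed.

Lemma diff_n_on_S (U : R * R -> Prop) (n : nat) (h : R -> R -> R) :
  diff_n_on U (S n) h <->
  (forall u v, U (u, v) -> continuity_2d_pt h u v /\
     ex_derive (fun s => h s v) u /\ ex_derive (fun t => h u t) v) /\
  diff_n_on U n (du h) /\ diff_n_on U n (dv h).
Proof.
  split.
  - intros hh. repeat split; try (now apply (hh u v H)); intros u v huv;
    now apply (hh u v huv).
  - intros [h0 [h1 h2]] u v huv. destruct (h0 u v huv) as [c [e1 e2]].
    exact (conj c (conj e1 (conj e2 (conj (h1 u v huv) (h2 u v huv))))).
Qed.

Lemma diff_n_on_pred (U : R * R -> Prop) (n : nat) (h : R -> R -> R) :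
  diff_n_on U (S n) h -> diff_n_on U n h.
Proof.
  intros hh u v huv. apply ex_diff_n_m with (n := S n); [auto | now apply hh].
Qed.

Lemma diff_n_on_const (U : R * R -> Prop) (n : nat) (c : R) :
  open U -> diff_n_on U n (fun _ _ => c).
Proof.
  intros hU. revert c. induction n as [|n IH]; intros c.
  - apply diff_n_on_0. intros. apply continuity_2d_pt_const.
  - apply diff_n_on_S. split; [|split].
    + intros. split; [apply continuity_2d_pt_const | split; apply ex_derive_const].
    + apply diff_n_on_ext with (h := fun _ _ => 0); auto.
      intros. symmetry. unfold du, dv. apply Derive_const.
    + apply diff_n_on_ext with (h := fun _ _ => 0); auto.
      intros. symmetry. unfold du, dv. apply Derive_const.
Qed.

Lemma diff_n_on_plus (U : R * R -> Prop) (n : nat) (h k : R -> R -> R) :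
  open U -> diff_n_on U n h -> diff_n_on U n k ->
  diff_n_on U n (fun u v => h u v + k u v).
Proof.
  intros hU. revert h k. induction n as [|n IH]; intros h k hh hk.
  - apply diff_n_on_0. intros. apply continuity_2d_pt_plus.
    now apply (proj1 (diff_n_on_0 U h) hh). now apply (proj1 (diff_n_on_0 U k) hk).
  - apply diff_n_on_S in hh. apply diff_n_on_S in hk.
    destruct hh as [h0 [h1 h2]]. destruct hk as [k0 [k1 k2]].
    apply diff_n_on_S. split; [|split].
    + intros u v huv. destruct (h0 u v huv) as [? [? ?]], (k0 u v huv) as [? [? ?]].
      split; [now apply continuity_2d_pt_plus|]. split; auto_derive; auto.
    + apply diff_n_on_ext with (h := fun u v => du h u v + du k u v); auto.
      intros u v huv. destruct (h0 u v huv) as [? [? ?]], (k0 u v huv) as [? [? ?]].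
      symmetry. unfold du, dv. now apply Derive_plus.
    + apply diff_n_on_ext with (h := fun u v => dv h u v + dv k u v); auto.
      intros u v huv. destruct (h0 u v huv) as [? [? ?]], (k0 u v huv) as [? [? ?]].
      symmetry. unfold du, dv. now apply Derive_plus.
Qed.

Lemma diff_n_on_mult (U : R * R -> Prop) (n : nat) (h k : R -> R -> R) :
  open U -> diff_n_on U n h -> diff_n_on U n k ->
  diff_n_on U n (fun u v => h u v * k u v).
Proof.
  intros hU. revert h k. induction n as [|n IH]; intros h k hh hk.
  - apply diff_n_on_0. intros. apply continuity_2d_pt_mult.
    now apply (proj1 (diff_n_on_0 U h) hh). now apply (proj1 (diff_n_on_0 U k) hk).
  (* Leibniz's rule pairs each derivative with an undifferentiated factor, so the factors themselves
     must also be known at order [n]. *)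
  - pose proof (diff_n_on_pred _ _ _ hh) as hh'. pose proof (diff_n_on_pred _ _ _ hk) as hk'.
    apply diff_n_on_S in hh. apply diff_n_on_S in hk.
    destruct hh as [h0 [h1 h2]]. destruct hk as [k0 [k1 k2]].
    apply diff_n_on_S. split; [|split].
    + intros u v huv. destruct (h0 u v huv) as [? [? ?]], (k0 u v huv) as [? [? ?]].
      split; [now apply continuity_2d_pt_mult|]. split; auto_derive; auto.
    + apply diff_n_on_ext with (h := fun u v => du h u v * k u v + h u v * du k u v); auto.
      * intros u v huv. destruct (h0 u v huv) as [? [? ?]], (k0 u v huv) as [? [? ?]].
        symmetry. unfold du, dv. now apply (Derive_mult (fun s => h s v) (fun s => k s v)).
      * apply diff_n_on_plus; auto.
    + apply diff_n_on_ext with (h := fun u v => dv h u v * k u v + h u v * dv k u v); auto.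
      * intros u v huv. destruct (h0 u v huv) as [? [? ?]], (k0 u v huv) as [? [? ?]].
        symmetry. unfold du, dv. now apply (Derive_mult (fun t => h u t) (fun t => k u t)).
      * apply diff_n_on_plus; auto.
Qed.

Lemma diff_n_on_inv (U : R * R -> Prop) (n : nat) (h : R -> R -> R) :
  open U -> (forall u v, U (u, v) -> h u v <> 0) ->
  diff_n_on U n h -> diff_n_on U n (fun u v => / h u v).
Proof.
  intros hU nz. induction n as [|n IH]; intros hh.
  - apply diff_n_on_0. intros. apply continuity_2d_pt_inv; auto.
    now apply (proj1 (diff_n_on_0 U h) hh).
  - pose proof (IH (diff_n_on_pred _ _ _ hh)) as hi.
    apply diff_n_on_S in hh. destruct hh as [h0 [h1 h2]].
    apply diff_n_on_S. split; [|split].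
    + intros u v huv. destruct (h0 u v huv) as [? [? ?]].
      split; [apply continuity_2d_pt_inv; auto|]. split; auto_derive; auto.
    (* Written with [/ h] as a factor instead of a quotient by [h ^ 2], the derivative falls under
       the induction hypothesis and the product rule. *)
    + apply diff_n_on_ext with (h := fun u v => -1 * du h u v * (/ h u v * / h u v)); auto.
      * intros u v huv. destruct (h0 u v huv) as [? [? ?]]. unfold du.
        rewrite (Derive_inv (fun s => h s v)); auto. cbv beta. field. now apply nz.
      * repeat apply diff_n_on_mult; auto. now apply diff_n_on_const.
    + apply diff_n_on_ext with (h := fun u v => -1 * dv h u v * (/ h u v * / h u v)); auto.
      * intros u v huv. destruct (h0 u v huv) as [? [? ?]]. unfold dv.
        rewrite (Derive_inv (fun t => h u t)); auto. cbv beta. field. now apply nz.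
      * repeat apply diff_n_on_mult; auto. now apply diff_n_on_const.
Qed.

Lemma diff_n_on_fst (U : R * R -> Prop) (n : nat) :
  open U -> diff_n_on U n (fun u _ => u).
Proof.
  intros hU. destruct n as [|n].
  - apply diff_n_on_0. intros. apply continuity_2d_pt_id1.
  - apply diff_n_on_S. split; [|split].
    + intros. split; [apply continuity_2d_pt_id1 |].
      split; [apply ex_derive_id | apply ex_derive_const].
    + apply diff_n_on_ext with (h := fun _ _ => 1); [exact hU | | now apply diff_n_on_const].
      intros. symmetry. apply Derive_id.
    + apply diff_n_on_ext with (h := fun _ _ => 0); [exact hU | | now apply diff_n_on_const].
      intros. symmetry. unfold dv. apply Derive_const.
Qed.

Lemma diff_n_on_snd (U : R * R -> Prop) (n : nat) :
  open U -> diff_n_on U n (fun _ v => v).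
Proof.
  intros hU. destruct n as [|n].
  - apply diff_n_on_0. intros. apply continuity_2d_pt_id2.
  - apply diff_n_on_S. split; [|split].
    + intros. split; [apply continuity_2d_pt_id2 |].
      split; [apply ex_derive_const | apply ex_derive_id].
    + apply diff_n_on_ext with (h := fun _ _ => 0); [exact hU | | now apply diff_n_on_const].
      intros. symmetry. unfold du. apply Derive_const.
    + apply diff_n_on_ext with (h := fun _ _ => 1); [exact hU | | now apply diff_n_on_const].
      intros. symmetry. apply Derive_id.
Qed.

Section SmoothFunctions.

Variable U : R * R -> Prop.
Hypothesis hU : open U.

Lemma smooth_const (c : R) : smooth_fun U (fun _ _ => c).
Proof. intros n. now apply diff_n_on_const. Qed.

Lemma smooth_fst : smooth_fun U (fun u _ => u).
Proof. intros n. now apply diff_n_on_fst. Qed.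

Lemma smooth_snd : smooth_fun U (fun _ v => v).
Proof. intros n. now apply diff_n_on_snd. Qed.

Lemma smooth_plus (h k : R -> R -> R) :
  smooth_fun U h -> smooth_fun U k -> smooth_fun U (fun u v => h u v + k u v).
Proof. intros hh hk n. now apply diff_n_on_plus. Qed.

Lemma smooth_mult (h k : R -> R -> R) :
  smooth_fun U h -> smooth_fun U k -> smooth_fun U (fun u v => h u v * k u v).
Proof. intros hh hk n. now apply diff_n_on_mult. Qed.

Lemma smooth_ext (h k : R -> R -> R) :
  (forall u v, U (u, v) -> h u v = k u v) -> smooth_fun U h -> smooth_fun U k.
Proof. intros e hh n. now apply diff_n_on_ext with (h := h). Qed.

Lemma smooth_opp (h : R -> R -> R) :
  smooth_fun U h -> smooth_fun U (fun u v => - h u v).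
Proof.
  intros hh. apply smooth_ext with (h := fun u v => -1 * h u v).
  - intros. ring.
  - apply smooth_mult; [apply smooth_const | exact hh].
Qed.

Lemma smooth_minus (h k : R -> R -> R) :
  smooth_fun U h -> smooth_fun U k -> smooth_fun U (fun u v => h u v - k u v).
Proof. intros hh hk. apply smooth_plus; [|apply smooth_opp]; assumption. Qed.

Lemma smooth_div (h k : R -> R -> R) :
  (forall u v, U (u, v) -> k u v <> 0) ->
  smooth_fun U h -> smooth_fun U k -> smooth_fun U (fun u v => h u v / k u v).
Proof.
  intros nz hh hk. apply smooth_mult; [exact hh|].
  intros n. now apply diff_n_on_inv.
Qed.

Lemma smooth_pow (h : R -> R -> R) (n : nat) :
  smooth_fun U h -> smooth_fun U (fun u v => h u v ^ n).
Proof.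
  intros hh. induction n as [|n IH]; simpl; [apply smooth_const | now apply smooth_mult].
Qed.

Lemma smooth_du (h : R -> R -> R) : smooth_fun U h -> smooth_fun U (du h).
Proof. intros hh n. exact (proj1 (proj2 (proj1 (diff_n_on_S U n h) (hh (S n))))). Qed.

Lemma smooth_dv (h : R -> R -> R) : smooth_fun U h -> smooth_fun U (dv h).
Proof. intros hh n. exact (proj2 (proj2 (proj1 (diff_n_on_S U n h) (hh (S n))))). Qed.

Lemma smooth_is_derive_fst (h : R -> R -> R) (u v : R) :
  smooth_fun U h -> U (u, v) -> is_derive (fun s => h s v) u (du h u v).
Proof. intros hh huv. apply Derive_correct, (hh 1%nat u v huv). Qed.

Lemma smooth_is_derive_snd (h : R -> R -> R) (u v : R) :
  smooth_fun U h -> U (u, v) -> is_derive (fun t => h u t) v (dv h u v).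
Proof. intros hh huv. apply Derive_correct, (hh 1%nat u v huv). Qed.

Lemma du_ext (h k : R -> R -> R) (u v : R) :
  (forall s t, U (s, t) -> h s t = k s t) -> U (u, v) -> du h u v = du k u v.
Proof.
  intros e huv. apply Derive_ext_loc.
  now apply open_locally_fst with (U := U) (P := fun s t => h s t = k s t).
Qed.

Lemma dv_ext (h k : R -> R -> R) (u v : R) :
  (forall s t, U (s, t) -> h s t = k s t) -> U (u, v) -> dv h u v = dv k u v.
Proof.
  intros e huv. apply Derive_ext_loc.
  now apply open_locally_snd with (U := U) (P := fun s t => h s t = k s t).
Qed.

(** Symmetry of second derivatives enters three times: for the immersion it gives vanishing torsion,
    for the normal the Codazzi equation, for the umbilicity factor the closedness of its
    differential. *)
Lemma smooth_schwarz (h : R -> R -> R) (u v : R) :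
  smooth_fun U h -> U (u, v) -> du (dv h) u v = dv (du h) u v.
Proof.
  intros hh huv. apply Schwarz.
  - apply open_locally_2d with (U := U); auto. intros s t hst.
    repeat split; [apply (hh 1%nat s t hst) .. | |].
    + apply (smooth_dv h hh 1%nat s t hst).
    + apply (smooth_du h hh 1%nat s t hst).
  - exact (proj1 (smooth_du _ (smooth_dv _ hh) 0%nat u v huv)).
  - exact (proj1 (smooth_dv _ (smooth_du _ hh) 0%nat u v huv)).
Qed.

End SmoothFunctions.

(** * The orthonormal frame of a BCV space *)

(* Coordinates of [V] in the orthonormal frame
   [d dx - tau y dz, d dy + tau x dz, dz] with [d = bcv_factor kappa p]. *)
Definition frame_coord (kappa tau : R) (p V : vec) : vec := fun i =>
  let d := bcv_factor kappa p in
  match i with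
  | cX => V cX / d
  | cY => V cY / d
  | cZ => V cZ + tau * ((p cY * V cX - p cX * V cY) / d)
  end.

(* Rate of change of [frame_coord] when the point moves with velocity [A] and
   the vector with velocity [V']. *)
Definition frame_coord_rate (kappa tau : R) (p A V V' : vec) : vec := fun i =>
  let d := bcv_factor kappa p in
  let d' := kappa / 2 * (p cX * A cX + p cY * A cY) in
  match i with
  | cX => V' cX / d - V cX * d' / d ^ 2
  | cY => V' cY / d - V cY * d' / d ^ 2
  | cZ => V' cZ + tau * ((p cY * V' cX - p cX * V' cY + A cY * V cX - A cX * V cY) / d
                         - (p cY * V cX - p cX * V cY) * d' / d ^ 2)
  end.

(* In the frame, nabla_a v = a(v) + frame_conn a v. *)
Definition frame_conn (kappa tau x y : R) (a v : vec) : vec := fun i =>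
  let w := kappa / 2 * (x * a cY - y * a cX) in
  match i with
  | cX => w * v cY + tau * (a cY * v cZ + a cZ * v cY)
  | cY => - (w * v cX) - tau * (a cX * v cZ + a cZ * v cX)
  | cZ => tau * (a cX * v cY - a cY * v cX)
  end.

(** The first index is the direction of differentiation. The default 0 covers the z-derivatives,
    since the metric is invariant under vertical translation, and the coefficient of dz^2, which is
    constantly 1. *)
Definition bcv_coef_partial (kappa tau : R) (i j l : coord) (p : vec) : R :=
  let d := bcv_factor kappa p in
  let x := p cX in let y := p cY in
  match i, j, l with
  | cX, cX, cX => - (kappa * x * (1 + tau ^ 2 * y ^ 2) / d ^ 3)
  | cY, cX, cX => 2 * tau ^ 2 * y / d ^ 2 - kappa * y * (1 + tau ^ 2 * y ^ 2) / d ^ 3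
  | cX, cX, cY | cX, cY, cX => - (tau ^ 2 * y / d ^ 2) + kappa * tau ^ 2 * x ^ 2 * y / d ^ 3
  | cY, cX, cY | cY, cY, cX => - (tau ^ 2 * x / d ^ 2) + kappa * tau ^ 2 * x * y ^ 2 / d ^ 3
  | cX, cX, cZ | cX, cZ, cX => - (kappa * tau * x * y / 2 / d ^ 2)
  | cY, cX, cZ | cY, cZ, cX => tau / d - kappa * tau * y ^ 2 / 2 / d ^ 2
  | cX, cY, cY => 2 * tau ^ 2 * x / d ^ 2 - kappa * x * (1 + tau ^ 2 * x ^ 2) / d ^ 3
  | cY, cY, cY => - (kappa * y * (1 + tau ^ 2 * x ^ 2) / d ^ 3)
  | cX, cY, cZ | cX, cZ, cY => - (tau / d) + kappa * tau * x ^ 2 / 2 / d ^ 2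
  | cY, cY, cZ | cY, cZ, cY => kappa * tau * x * y / 2 / d ^ 2
  | _, _, _ => 0
  end.

Lemma bcv_partial (kappa tau : R) (i j l : coord) (p : vec) :
  bcv_factor kappa p <> 0 ->
  partial i (gcoef (bcv_metric kappa tau) j l) p = bcv_coef_partial kappa tau i j l p.
Proof.
  intros hd. unfold bcv_factor in hd. unfold partial. apply is_derive_unique.
  destruct i, j, l;
  unfold gcoef, bcv_metric, bcv_coef_partial, bcv_factor, upd, basis; simpl in *;
  auto_derive; repeat split; try apply Rmult_integral_contrapositive_currified;
  try field; lra.
Qed.

(** The inverse metric is the sum of the tensor squares of the three orthonormal frame vectors. *)
Definition bcv_inverse (kappa tau : R) (i j : coord) (p : vec) : R :=
  let d := bcv_factor kappa p in
  let x := p cX in let y := p cY in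
  match i, j with
  | cX, cX | cY, cY => d ^ 2
  | cX, cY | cY, cX => 0
  | cX, cZ | cZ, cX => - (tau * y * d)
  | cY, cZ | cZ, cY => tau * x * d
  | cZ, cZ => 1 + tau ^ 2 * (x ^ 2 + y ^ 2)
  end.

(** The orthonormal coframe is triangular in the coordinates with diagonal [1/d, 1/d, 1]; the metric
    determinant is the square of its determinant. *)
Lemma bcv_gdet (kappa tau : R) (p : vec) :
  bcv_factor kappa p <> 0 -> gdet (bcv_metric kappa tau) p = / bcv_factor kappa p ^ 4.
Proof.
  intros hd. unfold gdet, gcof, sum3, gcoef, bcv_metric, basis; simpl.
  generalize dependent (bcv_factor kappa p). intros d hd. now field.
Qed.

Lemma bcv_ginv (kappa tau : R) (i j : coord) (p : vec) :
  bcv_factor kappa p <> 0 ->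
  ginv (bcv_metric kappa tau) i j p = bcv_inverse kappa tau i j p.
Proof.
  intros hd. unfold ginv. rewrite bcv_gdet by exact hd.
  destruct i, j; unfold gcof, gcoef, bcv_metric, bcv_inverse, basis; simpl;
  generalize dependent (bcv_factor kappa p); intros d hd; now field.
Qed.

(** This is the passage from Christoffel symbols to the frame connection. Velocity and derivative of
    the field are free vectors [A] and [V'], so the claim is a pointwise rational identity in the
    coordinates. *)
Lemma frame_coord_cov (kappa tau : R) (p A V V' : vec) (i : coord) :
  bcv_factor kappa p <> 0 ->
  frame_coord kappa tau p (fun k => V' k + sum3 (fun i => sum3 (fun j =>
      christoffel (bcv_metric kappa tau) k i j p * A i * V j))) i
  = frame_coord_rate kappa tau p A V V' i
    + frame_conn kappa tau (p cX) (p cY)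
        (frame_coord kappa tau p A) (frame_coord kappa tau p V) i.
Proof.
  intros hd.
  destruct i;
  unfold frame_coord, frame_coord_rate, frame_conn, christoffel, sum3;
  rewrite ?bcv_ginv, ?bcv_partial by exact hd;
  unfold bcv_inverse, bcv_coef_partial, bcv_factor in *; field; lra.
Qed.

(* Coquelicot's rules restated on [R], so that they unify with the concrete operations. *)
Lemma is_derive_Rplus (f g : R -> R) (t f' g' : R) :
  is_derive f t f' -> is_derive g t g' -> is_derive (fun s => f s + g s) t (f' + g').
Proof. exact (is_derive_plus f g t f' g'). Qed.

Lemma is_derive_Rminus (f g : R -> R) (t f' g' : R) :
  is_derive f t f' -> is_derive g t g' -> is_derive (fun s => f s - g s) t (f' - g').
Proof. exact (is_derive_minus f g t f' g'). Qed.

Lemma is_derive_Ropp (f : R -> R) (t f' : R) :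
  is_derive f t f' -> is_derive (fun s => - f s) t (- f').
Proof. exact (is_derive_opp f t f'). Qed.

Lemma is_derive_Rmult (f g : R -> R) (t f' g' : R) :
  is_derive f t f' -> is_derive g t g' ->
  is_derive (fun s => f s * g s) t (f' * g t + f t * g').
Proof. intros hf hg. exact (is_derive_mult f g t f' g' hf hg Rmult_comm). Qed.

Lemma is_derive_Rconst (c t : R) : is_derive (fun _ => c) t 0.
Proof. exact (is_derive_const c t). Qed.

Ltac derive_rules :=
  lazymatch goal with
  | |- is_derive (fun s => _ + _) _ _ => apply is_derive_Rplus; derive_rules
  | |- is_derive (fun s => _ - _) _ _ => apply is_derive_Rminus; derive_rules
  | |- is_derive (fun s => - _) _ _ => apply is_derive_Ropp; derive_rules
  | |- is_derive (fun s => _ * _) _ _ => apply is_derive_Rmult; derive_rules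
  | |- is_derive (fun _ => ?c) _ _ => apply is_derive_Rconst
  | |- _ => eauto
  end.

Lemma is_derive_div_factor (kappa t x' y' v' : R) (x y v : R -> R) :
  1 + kappa / 4 * (x t ^ 2 + y t ^ 2) <> 0 ->
  is_derive x t x' -> is_derive y t y' -> is_derive v t v' ->
  is_derive (fun s => v s / (1 + kappa / 4 * (x s ^ 2 + y s ^ 2))) t
    (v' / (1 + kappa / 4 * (x t ^ 2 + y t ^ 2))
     - v t * (kappa / 2 * (x t * x' + y t * y')) / (1 + kappa / 4 * (x t ^ 2 + y t ^ 2)) ^ 2).
Proof.
  intros hd hx hy hv.
  evar_last.
  - apply is_derive_div; [exact hv | | exact hd].
    apply is_derive_Rplus; [apply is_derive_Rconst |].
    apply is_derive_scal, is_derive_Rplus; apply is_derive_pow; [exact hx | exact hy].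
  - simpl. field. lra.
Qed.

Lemma is_derive_frame_coord (kappa tau t : R) (p V : R -> vec) (A V' : vec) (i : coord) :
  bcv_factor kappa (p t) <> 0 ->
  (forall k, is_derive (fun s => p s k) t (A k)) ->
  (forall k, is_derive (fun s => V s k) t (V' k)) ->
  is_derive (fun s => frame_coord kappa tau (p s) (V s) i) t
    (frame_coord_rate kappa tau (p t) A (V t) V' i).
Proof.
  intros hd hp hV.
  pose proof (fun v v' => is_derive_div_factor kappa t _ _ v' _ _ v hd (hp cX) (hp cY)) as hq.
  destruct i; unfold frame_coord, frame_coord_rate, bcv_factor.
  - exact (hq _ _ (hV cX)).
  - exact (hq _ _ (hV cY)).
  - apply is_derive_Rplus; [apply hV|].
    apply (is_derive_scal (fun s => (p s cY * V s cX - p s cX * V s cY) / _)).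
    apply (hq (fun s => p s cY * V s cX - p s cX * V s cY)).
    evar_last; [derive_rules | cbv beta; ring].
Qed.

(** [frame_conn] is bilinear in its two vectors, and the base point enters only through the [kappa]
    term, linearly in [x] and [y]. Hence moving the point contributes [frame_conn] with [tau = 0],
    evaluated at the velocity. *)
Lemma is_derive_conn_rhs (kappa tau t x' y' lam' : R) (x y lam : R -> R)
    (a n : R -> vec) (a' n' : vec) (i : coord) :
  is_derive x t x' -> is_derive y t y' -> is_derive lam t lam' ->
  (forall k, is_derive (fun s => a s k) t (a' k)) ->
  (forall k, is_derive (fun s => n s k) t (n' k)) ->
  is_derive (fun s => - lam s * a s i - frame_conn kappa tau (x s) (y s) (a s) (n s) i) t
    (- lam' * a t i - lam t * a' i
     - frame_conn kappa tau (x t) (y t) a' (n t) i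
     - frame_conn kappa tau (x t) (y t) (a t) n' i
     - frame_conn kappa 0 x' y' (a t) (n t) i).
Proof.
  intros hx hy hl ha hn.
  destruct i; unfold frame_conn;
  (evar_last; [derive_rules | cbv beta; ring]).
Qed.

(** * Codazzi and integrability equations *)

Definition dot (v w : vec) : R := sum3 (fun k => v k * w k).

(** The last hypothesis is the equality of the mixed derivatives of the normal, after inserting the
    Weingarten equations. Removing [av], [nu], [nv] leaves [lv a - lu b = R(a,b) n], with [R] the
    curvature of the BCV space. *)
Lemma codazzi_algebra (kappa tau x y lam lu lv : R) (a b n nu nv au av bu bv : vec) :
  let d := 1 + kappa / 4 * (x ^ 2 + y ^ 2) in
  let K := kappa - 4 * tau ^ 2 in
  dot a n = 0 -> dot b n = 0 ->
  (forall i, av i + frame_conn kappa tau x y b a i = bu i + frame_conn kappa tau x y a b i) ->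
  (forall i, nu i = - lam * a i - frame_conn kappa tau x y a n i) ->
  (forall i, nv i = - lam * b i - frame_conn kappa tau x y b n i) ->
  (forall i,
     - lv * a i - lam * av i - frame_conn kappa tau x y av n i
     - frame_conn kappa tau x y a nv i - frame_conn kappa 0 (d * b cX) (d * b cY) a n i
   = - lu * b i - lam * bu i - frame_conn kappa tau x y bu n i
     - frame_conn kappa tau x y b nu i - frame_conn kappa 0 (d * a cX) (d * a cY) b n i) ->
  forall i, (lv + K * n cZ * b cZ) * a i = (lu + K * n cZ * a cZ) * b i.
Proof.
  intros d K han hbn ht hu hv hs i.
  assert (forall j, av j = bu j + frame_conn kappa tau x y a b j - frame_conn kappa tau x y b a j)
    as hav by (intros j; specialize (ht j); lra).
  specialize (hs i).
  unfold dot, sum3 in han, hbn. unfold d, K in *.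
  (* The right side collects the terms of [R(a,b) n] containing [<a,n>] or [<b,n>], which vanish for
     tangent [a], [b]; [basis cZ] is xi. The terms with [n cZ] are moved to the left. *)
  assert (e : (lv + (kappa - 4 * tau ^ 2) * n cZ * b cZ) * a i
    - (lu + (kappa - 4 * tau ^ 2) * n cZ * a cZ) * b i
    = (kappa - 3 * tau ^ 2) * ((b cX * n cX + b cY * n cY + b cZ * n cZ) * a i
       - (a cX * n cX + a cY * n cY + a cZ * n cZ) * b i)
      - (kappa - 4 * tau ^ 2) * ((b cX * n cX + b cY * n cY + b cZ * n cZ) * a cZ
       - (a cX * n cX + a cY * n cY + a cZ * n cZ) * b cZ) * basis cZ i).
  { apply Rminus_diag_uniq. apply Rminus_diag_eq in hs.
    (* The goal's difference is minus the difference of the two sides of [hs]. *)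
    match goal with |- ?l = 0 => match type of hs with ?r = 0 =>
      cut (l = - r); [intros ->; rewrite hs; ring|] end end.
    destruct i; unfold frame_conn, basis in *; simpl in *;
    rewrite ?hav, ?hu, ?hv; field. }
  rewrite han, hbn in e. lra.
Qed.

Definition independent (a b : vec) : Prop :=
  forall s t, (forall i, s * a i + t * b i = 0) -> s = 0 /\ t = 0.

Lemma independent_dot_pos (a b : vec) : independent a b -> 0 < dot a a.
Proof.
  intros hab. unfold dot, sum3.
  destruct (Req_dec (a cX) 0) as [e1|e1]; [destruct (Req_dec (a cY) 0) as [e2|e2];
    [destruct (Req_dec (a cZ) 0) as [e3|e3]|]|]; try nra.
  destruct (hab 1 0); [|lra]. intros []; lra.
Qed.

(* [W] is the triple product of [a], [b], [n]. *)
Lemma normal_cross (a b n : vec) :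
  independent a b -> dot a n = 0 -> dot b n = 0 -> dot n n = 1 ->
  exists W, W <> 0 /\ a cY * b cZ - a cZ * b cY = W * n cX /\
    a cZ * b cX - a cX * b cZ = W * n cY /\ a cX * b cY - a cY * b cX = W * n cZ.
Proof.
  unfold dot, sum3. intros hab han hbn hn.
  set (W := n cX * (a cY * b cZ - a cZ * b cY) + n cY * (a cZ * b cX - a cX * b cZ)
            + n cZ * (a cX * b cY - a cY * b cX)).
  assert (h1 : a cY * b cZ - a cZ * b cY = W * n cX).
  (* Multiplying by [<n,n> = 1] and adding multiples of [<a,n> = <b,n> = 0] turns
     [a x b = <n, a x b> n] into a polynomial identity, one component at a time. *)
  { replace (a cY * b cZ - a cZ * b cY) with ((a cY * b cZ - a cZ * b cY)
      * (n cX * n cX + n cY * n cY + n cZ * n cZ)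
      + (a cX * n cX + a cY * n cY + a cZ * n cZ) * (b cY * n cZ - b cZ * n cY)
      - (b cX * n cX + b cY * n cY + b cZ * n cZ) * (a cY * n cZ - a cZ * n cY)) at 1
      by (rewrite han, hbn, hn; ring). unfold W; ring. }
  assert (h2 : a cZ * b cX - a cX * b cZ = W * n cY).
  { replace (a cZ * b cX - a cX * b cZ) with ((a cZ * b cX - a cX * b cZ)
      * (n cX * n cX + n cY * n cY + n cZ * n cZ)
      + (a cX * n cX + a cY * n cY + a cZ * n cZ) * (b cZ * n cX - b cX * n cZ)
      - (b cX * n cX + b cY * n cY + b cZ * n cZ) * (a cZ * n cX - a cX * n cZ)) at 1
      by (rewrite han, hbn, hn; ring). unfold W; ring. }
  assert (h3 : a cX * b cY - a cY * b cX = W * n cZ).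
  { replace (a cX * b cY - a cY * b cX) with ((a cX * b cY - a cY * b cX)
      * (n cX * n cX + n cY * n cY + n cZ * n cZ)
      + (a cX * n cX + a cY * n cY + a cZ * n cZ) * (b cX * n cY - b cY * n cX)
      - (b cX * n cX + b cY * n cY + b cZ * n cZ) * (a cX * n cY - a cY * n cX)) at 1
      by (rewrite han, hbn, hn; ring). unfold W; ring. }
  exists W. repeat split; auto. intros hW. rewrite hW in *.
  (* If [a x b = 0], then [- b k] times [a] plus [a k] times [b] is zero for every [k], and
     independence kills [a k]. *)
  assert (ha : forall k, a k = 0).
  { intros k. destruct (hab (- b k) (a k)) as [_ e]; auto.
    intros i. destruct i, k; lra. }
  destruct (hab 1 0); [|lra]. intros i. rewrite ha. ring.
Qed.

(* The equation relating [nv cZ] and [nu cZ] is the closedness of <N, xi> T^b. *)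
Lemma integrability_algebra (kappa tau x y lam : R) (a b n nu nv au av bu bv : vec) :
  independent a b -> dot a n = 0 -> dot b n = 0 -> dot n n = 1 ->
  (forall i, av i + frame_conn kappa tau x y b a i = bu i + frame_conn kappa tau x y a b i) ->
  (forall i, nu i = - lam * a i - frame_conn kappa tau x y a n i) ->
  (forall i, nv i = - lam * b i - frame_conn kappa tau x y b n i) ->
  nv cZ * a cZ + n cZ * av cZ = nu cZ * b cZ + n cZ * bu cZ ->
  tau <> 0 ->
  3 * (n cZ * n cZ) = 1 /\ (nu cZ = 0 -> nv cZ = 0 -> False).
Proof.
  intros hab han hbn hn ht hu hv hs htau.
  destruct (normal_cross a b n hab han hbn hn) as [W [hW [h1 [h2 h3]]]].
  pose proof (ht cZ) as ht3. pose proof (hu cZ) as hu3. pose proof (hv cZ) as hv3.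
  unfold frame_conn in ht3, hu3, hv3.
  (* This is d T^b = 2 tau <N, xi> dA in coordinates. *)
  assert (e : av cZ = bu cZ + 2 * tau * (W * n cZ)) by (rewrite <- h3; lra).
  (* The [lam] terms cancel in [hs], leaving [2 nZ^2 - nX^2 - nY^2] times [tau * W]; the unit length
     of [n] rewrites this as [3 nZ^2 - 1]. *)
  assert (h : tau * W * (3 * (n cZ * n cZ) - 1) = 0).
  { rewrite <- hn. unfold dot, sum3.
    replace (tau * W * (3 * (n cZ * n cZ) - (n cX * n cX + n cY * n cY + n cZ * n cZ)))
      with (2 * tau * n cZ * (W * n cZ) - tau * n cX * (W * n cX) - tau * n cY * (W * n cY))
      by ring.
    rewrite <- h1, <- h2.
    rewrite e, hu3, hv3 in hs. lra. }
  assert (h' : 3 * (n cZ * n cZ) = 1).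
  { apply Rmult_integral in h. destruct h as [h|h]; [|lra].
    apply Rmult_integral in h. tauto. }
  split; [exact h'|]. intros hu0 hv0. rewrite hu0, hv0, e in hs.
  assert (h4 : tau * W * (n cZ * n cZ) = 0) by lra.
  replace (n cZ * n cZ) with (/ 3) in h4 by lra.
  apply Rmult_integral in h4. destruct h4 as [h4|h4]; [|lra].
  apply Rmult_integral in h4. tauto.
Qed.

(** * The equations of an umbilical surface in frame coordinates *)

Section FrameSystem.

Variables (kappa tau : R) (U : R * R -> Prop).
Variables (x y : R -> R -> R) (a b n : R -> R -> vec).

Definition smooth_vec (V : R -> R -> vec) : Prop :=
  forall k, smooth_fun U (fun u v => V u v k).

Definition du_vec (V : R -> R -> vec) (u v : R) : vec := fun k => du (fun s t => V s t k) u v.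
Definition dv_vec (V : R -> R -> vec) (u v : R) : vec := fun k => dv (fun s t => V s t k) u v.

Hypotheses (hU : open U) (hx : smooth_fun U x) (hy : smooth_fun U y).
Hypotheses (ha : smooth_vec a) (hb : smooth_vec b) (hn : smooth_vec n).
(** The model case: [a], [b], [n] are the frame coordinates of f_u, f_v and the unit normal, and
    [x], [y] are the first two coordinates of f. The height has no equation, as [frame_conn] depends
    on the point through [x] and [y] alone. *)
Hypothesis hpos : forall u v, U (u, v) ->
  let d := 1 + kappa / 4 * (x u v ^ 2 + y u v ^ 2) in
  du x u v = d * a u v cX /\ du y u v = d * a u v cY /\
  dv x u v = d * b u v cX /\ dv y u v = d * b u v cY.
Hypothesis htorsion : forall u v, U (u, v) -> forall i,
  dv_vec a u v i + frame_conn kappa tau (x u v) (y u v) (b u v) (a u v) i =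
  du_vec b u v i + frame_conn kappa tau (x u v) (y u v) (a u v) (b u v) i.
Hypothesis hortho : forall u v, U (u, v) ->
  independent (a u v) (b u v) /\
  dot (a u v) (n u v) = 0 /\ dot (b u v) (n u v) = 0 /\ dot (n u v) (n u v) = 1.

(** Umbilicity supplies a factor at each point with no regularity, whereas the Codazzi argument
    differentiates it. Pairing the first Weingarten equation with [a] solves for the factor as a
    smooth quotient. *)
Lemma smooth_umbilicity_factor :
  (forall u v, U (u, v) -> exists lam,
    (forall i, du_vec n u v i =
       - lam * a u v i - frame_conn kappa tau (x u v) (y u v) (a u v) (n u v) i) /\
    (forall i, dv_vec n u v i =
       - lam * b u v i - frame_conn kappa tau (x u v) (y u v) (b u v) (n u v) i)) ->
  exists lam, smooth_fun U lam /\ forall u v, U (u, v) ->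
    (forall i, du_vec n u v i =
       - lam u v * a u v i - frame_conn kappa tau (x u v) (y u v) (a u v) (n u v) i) /\
    (forall i, dv_vec n u v i =
       - lam u v * b u v i - frame_conn kappa tau (x u v) (y u v) (b u v) (n u v) i).
Proof.
  intros humb.
  exists (fun u v => - (dot (a u v) (fun i => du_vec n u v i
    + frame_conn kappa tau (x u v) (y u v) (a u v) (n u v) i) / dot (a u v) (a u v))).
  split.
  - apply smooth_opp, smooth_div; auto.
    + intros u v huv. apply Rgt_not_eq, independent_dot_pos with (b := b u v), hortho, huv.
    + unfold dot, sum3, frame_conn, du_vec.
      repeat first [apply ha | apply hn | exact hx | exact hy | apply smooth_plus |
        apply smooth_minus | apply smooth_opp | apply smooth_mult | apply smooth_du |
        apply smooth_const]; auto.
    + unfold dot, sum3. repeat first [apply ha | apply smooth_plus | apply smooth_mult]; auto.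
  - intros u v huv. destruct (humb u v huv) as [lam [h1 h2]].
    pose proof (independent_dot_pos _ _ (proj1 (hortho u v huv))) as hp.
    match goal with |- context [- ?l * a u v _ - _] => replace l with lam; [now split|] end.
    unfold dot, sum3 in *. rewrite !h1. field. lra.
Qed.

Variable lam : R -> R -> R.
Hypothesis hlam : smooth_fun U lam.
Hypothesis humb : forall u v, U (u, v) ->
  (forall i, du_vec n u v i =
     - lam u v * a u v i - frame_conn kappa tau (x u v) (y u v) (a u v) (n u v) i) /\
  (forall i, dv_vec n u v i =
     - lam u v * b u v i - frame_conn kappa tau (x u v) (y u v) (b u v) (n u v) i).

(** Both first derivatives of [n] are replaced by their Weingarten expressions before equating mixed
    derivatives. The Codazzi identity is then a linear relation between [a] and [b], so its
    coefficients vanish. *)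
Lemma umbilicity_factor_gradient (u v : R) : U (u, v) ->
  du lam u v = - (kappa - 4 * tau ^ 2) * (n u v cZ * a u v cZ) /\
  dv lam u v = - (kappa - 4 * tau ^ 2) * (n u v cZ * b u v cZ).
Proof.
  intros huv. destruct (hortho u v huv) as [hab [han [hbn hnn]]].
  destruct (hpos u v huv) as [hxu [hyu [hxv hyv]]].
  assert (forall i, (dv lam u v + (kappa - 4 * tau ^ 2) * n u v cZ * b u v cZ) * a u v i
    = (du lam u v + (kappa - 4 * tau ^ 2) * n u v cZ * a u v cZ) * b u v i) as h.
  { apply (codazzi_algebra kappa tau (x u v) (y u v) (lam u v)) with
      (n := n u v) (nu := du_vec n u v) (nv := dv_vec n u v) (av := dv_vec a u v)
      (bu := du_vec b u v); auto; try apply humb; auto.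
    intros i. rewrite <- hxu, <- hyu, <- hxv, <- hyv.
    assert (e : du (fun s t => dv_vec n s t i) u v = dv (fun s t => du_vec n s t i) u v)
      by exact (smooth_schwarz U hU _ u v (hn i) huv).
    rewrite (du_ext U hU _ _ u v (fun s t hst => proj2 (humb s t hst) i) huv) in e.
    rewrite (dv_ext U hU _ _ u v (fun s t hst => proj1 (humb s t hst) i) huv) in e.
    symmetry. etransitivity; [|etransitivity; [exact e|]].
    - symmetry. apply is_derive_unique.
      apply (is_derive_conn_rhs kappa tau u _ _ _ (fun s => x s v) (fun s => y s v)
        (fun s => lam s v) (fun s => b s v) (fun s => n s v));
      try (now apply (smooth_is_derive_fst U)); intros k.
      + exact (smooth_is_derive_fst U _ u v (hb k) huv).
      + exact (smooth_is_derive_fst U _ u v (hn k) huv).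
    - apply is_derive_unique.
      apply (is_derive_conn_rhs kappa tau v _ _ _ (fun t => x u t) (fun t => y u t)
        (fun t => lam u t) (fun t => a u t) (fun t => n u t));
      try (now apply (smooth_is_derive_snd U)); intros k.
      + exact (smooth_is_derive_snd U _ u v (ha k) huv).
      + exact (smooth_is_derive_snd U _ u v (hn k) huv). }
  destruct (hab (dv lam u v + (kappa - 4 * tau ^ 2) * n u v cZ * b u v cZ)
    (- (du lam u v + (kappa - 4 * tau ^ 2) * n u v cZ * a u v cZ))) as [h1 h2].
  - intros i. rewrite h. ring.
  - split; lra.
Qed.

Lemma umbilical_frame_system_tau :
  (exists w, U w) -> kappa <> 4 * tau ^ 2 -> tau = 0.
Proof.
  intros [[u v] huv] hk. destruct (Req_dec tau 0) as [h0|h0]; [exact h0|exfalso].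
  pose proof (fun s t hst => smooth_is_derive_fst U _ s t (hn cZ) hst) as hnu.
  pose proof (fun s t hst => smooth_is_derive_snd U _ s t (hn cZ) hst) as hnv.
  (* The gradient of [lam] is [-(kappa - 4 tau^2)] times the components of <N, xi> T^b. Equality of
     its mixed derivatives, divided by that nonzero constant, is the closedness. *)
  assert (hint : forall s t, U (s, t) ->
    dv_vec n s t cZ * a s t cZ + n s t cZ * dv_vec a s t cZ
    = du_vec n s t cZ * b s t cZ + n s t cZ * du_vec b s t cZ).
  { intros s t hst.
    pose proof (smooth_schwarz U hU _ s t hlam hst) as e.
    rewrite (du_ext U hU _ _ s t
      (fun p q hpq => proj2 (umbilicity_factor_gradient p q hpq)) hst) in e.
    rewrite (dv_ext U hU _ _ s t
      (fun p q hpq => proj1 (umbilicity_factor_gradient p q hpq)) hst) in e.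
    apply Rmult_eq_reg_l with (r := - (kappa - 4 * tau ^ 2)); [|lra].
    symmetry. etransitivity; [|etransitivity; [exact e|]].
    - symmetry. apply is_derive_unique, is_derive_scal.
      apply (is_derive_Rmult (fun s => n s t cZ) (fun s => b s t cZ)); [now apply hnu|].
      now apply (smooth_is_derive_fst U (fun s t => b s t cZ)).
    - apply is_derive_unique, is_derive_scal.
      apply (is_derive_Rmult (fun t => n s t cZ) (fun t => a s t cZ)); [now apply hnv|].
      now apply (smooth_is_derive_snd U (fun s t => a s t cZ)). }
  assert (hang : forall s t, U (s, t) -> 3 * (n s t cZ * n s t cZ) = 1 /\
    (du_vec n s t cZ = 0 -> dv_vec n s t cZ = 0 -> False)).
  { intros s t hst. destruct (hortho s t hst) as [hab [han [hbn hnn]]].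
    destruct (humb s t hst) as [h1 h2].
    apply (integrability_algebra kappa tau (x s t) (y s t) (lam s t)) with
      (a := a s t) (b := b s t) (av := dv_vec a s t) (bu := du_vec b s t); auto. }
  destruct (hang u v huv) as [h3 hF].
  assert (hnz : n u v cZ <> 0) by (intros e; rewrite e in h3; lra).
  (* Since the square of [n cZ] is 1/3 on all of [U], differentiating it gives [2 * n cZ] times each
     derivative equal to 0, so both derivatives vanish at the chosen point. *)
  assert (hsq : forall s t, U (s, t) -> n s t cZ * n s t cZ = / 3)
    by (intros s t hst; destruct (hang s t hst); lra).
  apply hF.
  - apply Rmult_eq_reg_l with (r := n u v cZ); [|exact hnz].
    assert (e : Derive (fun s => n s v cZ * n s v cZ) u = 0)
      by exact (eq_trans (du_ext U hU _ _ u v hsq huv) (Derive_const _ _)).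
    pose proof (is_derive_Rmult _ _ _ _ _ (hnu u v huv) (hnu u v huv)) as e'.
    apply is_derive_unique in e'. pose proof (eq_trans (eq_sym e') e).
    unfold du_vec. lra.
  - apply Rmult_eq_reg_l with (r := n u v cZ); [|exact hnz].
    assert (e : Derive (fun t => n u t cZ * n u t cZ) v = 0)
      by exact (eq_trans (dv_ext U hU _ _ u v hsq huv) (Derive_const _ _)).
    pose proof (is_derive_Rmult _ _ _ _ _ (hnv u v huv) (hnv u v huv)) as e'.
    apply is_derive_unique in e'. pose proof (eq_trans (eq_sym e') e).
    unfold dv_vec. lra.
Qed.

End FrameSystem.

(** * Umbilical patches *)

Lemma pushforward_fst (V : R -> R -> vec) (u v : R) :
  pushforward V u v 1 0 = du_vec V u v.
Proof.
  apply functional_extensionality. intros k. unfold pushforward, du_vec, du. ring.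
Qed.

Lemma pushforward_snd (V : R -> R -> vec) (u v : R) :
  pushforward V u v 0 1 = dv_vec V u v.
Proof.
  apply functional_extensionality. intros k. unfold pushforward, dv_vec, dv. ring.
Qed.

Lemma bcv_metric_dot (kappa tau : R) (p V W : vec) :
  bcv_factor kappa p <> 0 ->
  bcv_metric kappa tau p V W = dot (frame_coord kappa tau p V) (frame_coord kappa tau p W).
Proof.
  intros hd. unfold bcv_metric, dot, sum3, frame_coord. field. exact hd.
Qed.

Lemma frame_coord_lin (kappa tau s t : R) (p V W : vec) (i : coord) :
  frame_coord kappa tau p (fun k => s * V k + t * W k) i
  = s * frame_coord kappa tau p V i + t * frame_coord kappa tau p W i.
Proof. destruct i; unfold frame_coord, Rdiv; ring. Qed.

Lemma frame_coord_eq0 (kappa tau : R) (p V : vec) :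
  bcv_factor kappa p <> 0 ->
  (forall i, frame_coord kappa tau p V i = 0) -> forall k, V k = 0.
Proof.
  intros hd h.
  assert (h1 : V cX = 0).
  { replace (V cX) with (bcv_factor kappa p * frame_coord kappa tau p V cX);
    [rewrite h; ring | simpl; now field]. }
  assert (h2 : V cY = 0).
  { replace (V cY) with (bcv_factor kappa p * frame_coord kappa tau p V cY);
    [rewrite h; ring | simpl; now field]. }
  pose proof (h cZ) as h3. simpl in h3. rewrite h1, h2 in h3.
  intros []; auto. rewrite <- h3. unfold Rdiv. ring.
Qed.

(** With [V], [W] the two coordinate velocities of a surface and [M] its common mixed second
    derivative, this is the symmetry nabla_v f_u = nabla_u f_v. *)
Lemma frame_torsion_free (kappa tau : R) (p V W M : vec) (i : coord) :
  bcv_factor kappa p <> 0 ->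
  frame_coord_rate kappa tau p W V M i
    + frame_conn kappa tau (p cX) (p cY)
        (frame_coord kappa tau p W) (frame_coord kappa tau p V) i
  = frame_coord_rate kappa tau p V W M i
    + frame_conn kappa tau (p cX) (p cY)
        (frame_coord kappa tau p V) (frame_coord kappa tau p W) i.
Proof.
  intros hd. destruct i; unfold frame_coord_rate, frame_conn, frame_coord;
  unfold bcv_factor in *; field; lra.
Qed.

Lemma smooth_frame_coord (kappa tau : R) (U : R * R -> Prop) (f V : R -> R -> vec) :
  open U -> (forall u v, U (u, v) -> bcv_factor kappa (f u v) <> 0) ->
  smooth_vec U f -> smooth_vec U V ->
  smooth_vec U (fun u v => frame_coord kappa tau (f u v) (V u v)).
Proof.
  intros hU hd hf hV.
  assert (hs : smooth_fun U (fun u v => bcv_factor kappa (f u v))).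
  { unfold bcv_factor.
    repeat first [apply smooth_const | apply smooth_plus | apply smooth_mult | apply smooth_pow];
    auto. }
  intros []; unfold frame_coord.
  - apply smooth_div; auto.
  - apply smooth_div; auto.
  - repeat first [apply hf | apply hV | apply smooth_const | apply smooth_div |
      apply smooth_minus | apply smooth_plus | apply smooth_mult]; auto.
Qed.

Section UmbilicalPatch.

Variables (kappa tau : R) (U : R * R -> Prop) (f N : R -> R -> vec).
Hypotheses (hU : open U) (hf : smooth_vec U f) (hN : smooth_vec U N).
Hypothesis hd : forall u v, U (u, v) -> bcv_factor kappa (f u v) <> 0.

Lemma du_frame_coord (V : R -> R -> vec) (u v : R) (i : coord) :
  smooth_vec U V -> U (u, v) ->
  du_vec (fun s t => frame_coord kappa tau (f s t) (V s t)) u v i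
  = frame_coord_rate kappa tau (f u v) (du_vec f u v) (V u v) (du_vec V u v) i.
Proof.
  intros hV huv. apply is_derive_unique.
  apply (is_derive_frame_coord kappa tau u (fun s => f s v) (fun s => V s v)); auto; intros k.
  - exact (smooth_is_derive_fst U _ u v (hf k) huv).
  - exact (smooth_is_derive_fst U _ u v (hV k) huv).
Qed.

Lemma dv_frame_coord (V : R -> R -> vec) (u v : R) (i : coord) :
  smooth_vec U V -> U (u, v) ->
  dv_vec (fun s t => frame_coord kappa tau (f s t) (V s t)) u v i
  = frame_coord_rate kappa tau (f u v) (dv_vec f u v) (V u v) (dv_vec V u v) i.
Proof.
  intros hV huv. apply is_derive_unique.
  apply (is_derive_frame_coord kappa tau v (fun t => f u t) (fun t => V u t)); auto; intros k.
  - exact (smooth_is_derive_snd U _ u v (hf k) huv).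
  - exact (smooth_is_derive_snd U _ u v (hV k) huv).
Qed.

Lemma frame_weingarten (lam : R) (p A V V' : vec) :
  bcv_factor kappa p <> 0 ->
  (forall k, - (V' k + sum3 (fun i => sum3 (fun j =>
     christoffel (bcv_metric kappa tau) k i j p * A i * V j))) = lam * A k) ->
  forall i, frame_coord_rate kappa tau p A V V' i =
    - lam * frame_coord kappa tau p A i
    - frame_conn kappa tau (p cX) (p cY)
        (frame_coord kappa tau p A) (frame_coord kappa tau p V) i.
Proof.
  intros hp h i. pose proof (frame_coord_cov kappa tau p A V V' i hp) as e.
  match type of e with frame_coord _ _ _ ?C _ = _ =>
    (* The summand [0 * A k] only gives the scalar multiple the two-term shape of
       [frame_coord_lin]. *)
    replace C with (fun k => - lam * A k + 0 * A k) in e end.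
  - rewrite frame_coord_lin in e. lra.
  - apply functional_extensionality. intros k. specialize (h k). lra.
Qed.

Hypothesis hind : forall u v, U (u, v) ->
  forall s t, (forall k, pushforward f u v s t k = 0) -> s = 0 /\ t = 0.
Hypothesis hnormal : forall u v, U (u, v) ->
  bcv_metric kappa tau (f u v) (N u v) (N u v) = 1 /\
  forall s t, bcv_metric kappa tau (f u v) (N u v) (pushforward f u v s t) = 0.

(** Frame coordinates of f_u, f_v and [N] satisfy the hypotheses of [FrameSystem]: the metric
    becomes [dot], and umbilicity in the directions (1,0) and (0,1) becomes the two Weingarten
    equations. *)
Lemma umbilical_patch_tau :
  (exists w, U w) -> totally_umbilical (bcv_metric kappa tau) U f N ->
  kappa <> 4 * tau ^ 2 -> tau = 0.
Proof.
  intros hne humb hk.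
  assert (hfu : smooth_vec U (du_vec f)) by (intros k; exact (smooth_du U _ (hf k))).
  assert (hfv : smooth_vec U (dv_vec f)) by (intros k; exact (smooth_dv U _ (hf k))).
  set (a := fun u v => frame_coord kappa tau (f u v) (du_vec f u v)).
  set (b := fun u v => frame_coord kappa tau (f u v) (dv_vec f u v)).
  set (n := fun u v => frame_coord kappa tau (f u v) (N u v)).
  set (x := fun u v => f u v cX). set (y := fun u v => f u v cY).
  assert (hx : smooth_fun U x) by apply hf.
  assert (hy : smooth_fun U y) by apply hf.
  assert (ha : smooth_vec U a) by now apply smooth_frame_coord.
  assert (hb : smooth_vec U b) by now apply smooth_frame_coord.
  assert (hn : smooth_vec U n) by now apply smooth_frame_coord.
  assert (hortho : forall u v, U (u, v) -> independent (a u v) (b u v) /\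
    dot (a u v) (n u v) = 0 /\ dot (b u v) (n u v) = 0 /\ dot (n u v) (n u v) = 1).
  { intros u v huv. destruct (hnormal u v huv) as [h1 h2].
    pose proof (h2 1 0) as h3. pose proof (h2 0 1) as h4.
    rewrite pushforward_fst in h3. rewrite pushforward_snd in h4.
    rewrite bcv_metric_dot in h1, h3, h4 by auto.
    split; [|repeat split; [| |exact h1]].
    - intros s t hst. apply (hind u v huv). apply frame_coord_eq0 with kappa tau (f u v); auto.
      intros i. rewrite <- (hst i). exact (frame_coord_lin _ _ s t _ _ _ i).
    - rewrite <- h3. unfold dot, sum3, a, n. ring.
    - rewrite <- h4. unfold dot, sum3, b, n. ring. }
  destruct (smooth_umbilicity_factor kappa tau U x y a b n) as [lam [hlam hW]]; auto.
  { intros u v huv. destruct (humb u v huv) as [lam h]. exists lam.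
    split; intros i.
    - unfold n. rewrite du_frame_coord by auto. apply frame_weingarten; auto.
      intros k. pose proof (h 1 0 k) as e. unfold shape_operator, cov_deriv in e.
      rewrite !pushforward_fst in e. exact e.
    - unfold n. rewrite dv_frame_coord by auto. apply frame_weingarten; auto.
      intros k. pose proof (h 0 1 k) as e. unfold shape_operator, cov_deriv in e.
      rewrite !pushforward_snd in e. exact e. }
  apply (umbilical_frame_system_tau kappa tau U x y a b n) with (lam := lam); auto.
  - intros u v huv. pose proof (hd u v huv) as h. unfold bcv_factor in h.
    unfold x, y, a, b, frame_coord, bcv_factor, du_vec, dv_vec.
    repeat split; field; lra.
  - intros u v huv i. unfold a, b. rewrite du_frame_coord, dv_frame_coord by auto.
    replace (dv_vec (du_vec f) u v) with (du_vec (dv_vec f) u v).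
    + apply frame_torsion_free. auto.
    + apply functional_extensionality. intros k.
      exact (smooth_schwarz U hU _ u v (hf k) huv).
Qed.

End UmbilicalPatch.

Lemma bcv_umbilical_tau (kappa tau : R) :
  kappa <> 4 * tau ^ 2 -> bcv_admits_totally_umbilical_surface kappa tau -> tau = 0.
Proof.
  intros hk [U [f [N [[hU [hne [hf hi]]] [[hN hn] humb]]]]].
  apply (umbilical_patch_tau kappa tau U f N); auto.
  - intros k n u v huv. now apply hf.
  - intros k n u v huv. now apply hN.
  - intros u v huv. apply Rgt_not_eq, (hi u v huv).
  - intros u v huv. apply (hi u v huv).
Qed.

(** * The totally geodesic slice of a product, and the classification *)

Lemma bcv_umbilical_product (kappa : R) : bcv_admits_totally_umbilical_surface kappa 0.
Proof.
  set (f := fun u v => fun k => match k with cX => u | cY => v | cZ => 0 end : R).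
  set (N := fun _ _ : R => basis cZ).
  (* For negative [kappa] the slice lies in the domain only over a disc, so the parameters are
     restricted to where the conformal factor is positive. *)
  set (U := fun w : R * R => 0 < 1 + kappa / 4 * (fst w ^ 2 + snd w ^ 2)).
  assert (hU : open U).
  { apply (open_comp (fun w : R * R => 1 + kappa / 4 * (fst w ^ 2 + snd w ^ 2)) (Rlt 0));
    [|apply open_gt].
    intros [u v] _.
    apply (proj1 (continuity_2d_pt_filterlim
      (fun s t => 1 + kappa / 4 * (s ^ 2 + t ^ 2)) u v)).
    assert (hs : smooth_fun (fun _ => True) (fun s t => 1 + kappa / 4 * (s ^ 2 + t ^ 2))).
    { apply smooth_plus, smooth_mult, smooth_plus; try apply smooth_pow;
      auto using open_true, smooth_const, smooth_fst, smooth_snd. }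
    exact (proj1 (hs 0%nat u v I)). }
  assert (hpf : forall u v a b, pushforward f u v a b =
    fun k => match k with cX => a | cY => b | cZ => 0 end).
  { intros. apply functional_extensionality. intros k. unfold pushforward.
    destruct k; simpl; rewrite ?Derive_id, ?Derive_const; ring. }
  exists U, f, N. split; [|split].
  - split; [exact hU|]. split; [|split].
    + exists (0, 0). unfold U; simpl. lra.
    + intros u v huv k n. destruct k; simpl;
      [now apply smooth_fst with (U := U) | now apply smooth_snd with (U := U) |
       now apply smooth_const with (U := U)].
    + intros u v huv. split; [exact huv|]. intros a b h. rewrite hpf in h.
      exact (conj (h cX) (h cY)).
  - split.
    + intros u v huv k n. unfold N. now apply smooth_const with (U := U).
    + intros u v huv. split; intros; rewrite ?hpf; unfold bcv_metric, N, basis, Rdiv; simpl; ring.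
  (* The normal has constant components, and for [tau = 0] every Christoffel symbol with a lower
     index z vanishes, so the shape operator is zero. *)
  - intros u v huv. exists 0. intros a b k.
    assert (hd : bcv_factor kappa (f u v) <> 0) by (apply Rgt_not_eq; exact huv).
    assert (hz : pushforward N u v a b k = 0).
    { unfold pushforward, N. rewrite !Derive_const. ring. }
    unfold shape_operator, cov_deriv. rewrite hz, hpf. unfold christoffel, sum3.
    rewrite !bcv_partial, !bcv_ginv by exact hd.
    destruct k; unfold bcv_coef_partial, bcv_inverse, N, basis, Rdiv; simpl; ring.
Qed.

Theorem theorem5 (kappa tau : R) (hkt : kappa <> 4 * tau ^ 2) :
  (bcv_admits_totally_umbilical_surface kappa tau <->
     (0 < kappa /\ tau = 0) \/ (kappa < 0 /\ tau = 0)) /\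
  (bcv_admits_totally_umbilical_surface kappa tau <-> tau = 0).
Proof.
  assert (h : bcv_admits_totally_umbilical_surface kappa tau <-> tau = 0).
  { split; [now apply bcv_umbilical_tau | intros ->; apply bcv_umbilical_product]. }
  split; [|exact h]. rewrite h. split; [|tauto]. intros ->.
  (* With [tau = 0] the hypothesis [hkt] says that [kappa] is nonzero, which leaves exactly the two
     signs. *)
  destruct (Rtotal_order kappa 0) as [?|[?|?]]; [auto | | auto].
  destruct hkt. simpl. lra.
Qed.
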